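(* Let $\alpha\in(0,1)$ and $\mu\in[0,1]$. Suppose that for each $m\in[0,1]$ we are given a nonnegative process $(M^m_t)_{t\ge 0}$ with $M^m_t = M^m(X_1,\dots,X_t)$ a function of $X_1,\dots,X_t$, such that the process $(M^\mu_t)_{t=0}^\infty$ indexed by $\mu$ has the following property: for each $P\in\mathcal P^\mu$, $(M^\mu_t)_{t=0}^\infty$ is upper-bounded by a test (super)martingale for $P$, possibly a different one for each $P$. For each $m\in[0,1]$ and $t\ge1$ define $\phi^m_t := \mathbf 1(M^m_t\ge 1/\alpha)$ and let $$C_t := \{m\in[0,1] : \phi^m_t = 0\}.$$ Then $(C_t)_{t=1}^\infty$ is a $(1-\alpha)$-confidence sequence for $\mu$: $$\sup_{P\in\mathcal P^\mu} P(\exists t\ge 1:\ \mu\notin C_t)\le\alpha.$$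
   Context: $(X_t)_{t=1}^\infty$ is the sequence of observations, $\mathcal F_t=\sigma(X_1,\dots,X_t)$ is the canonical filtration, with $\mathcal F_0$ trivial. For $m\in[0,1]$, $\mathcal P^m$ is the set of all distributions $P$ on $[0,1]^\infty$ such that, when $(X_t)_{t=1}^\infty\sim P$, $\mathbb E_P(X_t\mid \mathcal F_{t-1})=m$ for every $t\ge1$. A test supermartingale (resp. test martingale) for $P$ is a nonnegative process $(L_t)_{t=0}^\infty$ adapted to $(\mathcal F_t)$ with $L_0=1$ and $\mathbb E_P(L_t\mid\mathcal F_{t-1})\le L_{t-1}$ (resp. $=L_{t-1}$) for each $t\ge1$. (In)equalities between random quantities hold almost surely. *)

(* Defs.v *)
From HB Require Import structures.
From mathcomp Require Import all_boot all_order all_algebra.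
From mathcomp Require Import all_classical all_reals all_analysis.
From mathcomp Require Import measurable_realfun.

Set Implicit Arguments.
Unset Strict Implicit.
Unset Printing Implicit Defensive.

Import Order.TTheory GRing.Theory Num.Theory.

Local Open Scope classical_set_scope.
Local Open Scope ring_scope.

Definition unit_itv (R : realType) : Type := {x : R | 0 <= x <= 1}.

Lemma unit_itv0_subproof (R : realType) : (0 : R) <= (0 : R) <= (1 : R).
Proof. by rewrite lexx ler01. Qed.

HB.instance Definition _ (R : realType) := SubChoice.on (unit_itv R).
HB.instance Definition _ (R : realType) :=
  isPointed.Build (unit_itv R) (exist _ (0 : R) (unit_itv0_subproof R)).

Definition unit_itv_val (R : realType) (x : unit_itv R) : R := sval x.
Coercion unit_itv_val : unit_itv >-> Real.sort.

(* Borel sigma-algebra of [0, 1]: the trace of the one of R. *)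
HB.instance Definition _ (R : realType) :=
  Measurable.copy (unit_itv R) (g_sigma_algebra_preimageType (@unit_itv_val R)).

(* [0, 1]^oo. Coordinates are numbered from 0: for w : itv_seq R, the observation
   X_t, t >= 1, is w t.-1. *)
Definition itv_seq (R : realType) : Type := nat -> unit_itv R.

Definition cylinders (R : realType) : set (set (itv_seq R)) :=
  \bigcup_(i : nat) preimage_set_system setT (fun w : itv_seq R => w i) measurable.

HB.instance Definition _ (R : realType) := Pointed.on (itv_seq R).
HB.instance Definition _ (R : realType) :=
  Measurable.copy (itv_seq R) (g_sigma_algebraType (@cylinders R)).

(* (X_1, ..., X_t) *)
Definition history (R : realType) (t : nat) (w : itv_seq R)
    : t.-tuple (unit_itv R) :=
  [tuple w i | i < t].

Definition filtration (R : realType) (t : nat) : set (set (itv_seq R)) :=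
  g_sigma_algebra_preimage (@history R t).

Section conditional_expectation.
Context d (T : measurableType d) (R : realType).

Definition measurable_wrt d' (T' : measurableType d')
    (G : set (set T)) (f : T -> T') : Prop :=
  forall B, measurable B -> G (f @^-1` B).

(* Y is a version of E_P(f | G), for f integrable or almost surely
   nonnegative. Versions are almost surely unique, so an almost sure statement
   about E_P(f | G) is phrased below as one about some version. *)
Definition is_cond_exp (P : probability T R) (G : set (set T))
    (f Y : T -> \bar R) : Prop :=
  measurable_wrt G Y /\
  forall A, G A -> (\int[P]_(w in A) Y w = \int[P]_(w in A) f w)%E.

End conditional_expectation.

(* The set P^m; w t is X_(t+1), so this is E_P(X_(t+1) | F_t) = m, t >= 0. *)
Definition mean_distributions (R : realType) (m : unit_itv R)
    : set (probability (itv_seq R) R) :=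
  [set P | forall t, exists2 Y,
     is_cond_exp P (filtration t) (fun w => (w t : R)%:E) Y
     & {ae P, forall w, Y w = (m : R)%:E}].

(* As for all relations between random variables here, L >= 0 and L_0 = 1 are
   only required almost surely. *)
Definition nonneg_adapted_unit_start (R : realType)
    (P : probability (itv_seq R) R) (L : nat -> itv_seq R -> R) : Prop :=
  [/\ forall t, measurable_wrt (filtration t) (L t),
      forall t, {ae P, forall w, 0 <= L t w}
    & {ae P, forall w, L 0%N w = 1}].

Definition test_supermartingale (R : realType)
    (P : probability (itv_seq R) R) (L : nat -> itv_seq R -> R) : Prop :=
  nonneg_adapted_unit_start P L /\
  forall t, exists2 Y,
    is_cond_exp P (filtration t) (fun w => (L t.+1 w)%:E) Y
    & {ae P, forall w, (Y w <= (L t w)%:E)%E}.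

Definition test_martingale (R : realType)
    (P : probability (itv_seq R) R) (L : nat -> itv_seq R -> R) : Prop :=
  nonneg_adapted_unit_start P L /\
  forall t, exists2 Y,
    is_cond_exp P (filtration t) (fun w => (L t.+1 w)%:E) Y
    & {ae P, forall w, Y w = (L t w)%:E}.

Section confidence_sets.
Context (R : realType) (alpha : R)
  (M : unit_itv R -> forall t : nat, t.-tuple (unit_itv R) -> R).

Definition level_test (m : unit_itv R) (t : nat) : itv_seq R -> R :=
  \1_[set w | 1 / alpha <= M m (history t w)].

Definition confidence_set (t : nat) (w : itv_seq R) : set (unit_itv R) :=
  [set m | level_test m t w = 0].

End confidence_sets.

(* Main.v *)
Require Import Defs.
From HB Require Import structures.
From mathcomp Require Import all_boot all_order all_algebra.
From mathcomp Require Import all_classical all_reals all_analysis.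
From mathcomp Require Import measurable_realfun.

(** The result is Ville's maximal inequality (lemma [ville]) applied to the
    (super)martingale [L] that dominates the process of index [mu] under a given
    [P] of mean [mu]. The set [confidence_set] misses [mu] at time [t] exactly
    when [M mu t >= 1 / alpha]; almost surely this forces [L t >= 1 / alpha],
    and by Ville's inequality a nonnegative supermartingale of initial
    expectation 1 ever reaches [1 / alpha] with probability at most [alpha].
    Only [L] enters the probabilistic argument, so it is harmless that it
    depends on [P]; the supremum over [P] is then immediate.

    Ville's inequality is proved without stopping times. Let [U t] be the event
    that [L] has reached the level [c] strictly before time [t]. The quantity
    [c * P (U t) + E (L t; not U t)] is nonincreasing in [t]: the mass of paths
    that first reach [c] at time [t] moves from the second term to the first,
    where it is weighted by [c <= L t], and the supermartingale property
    cannot increase what is left of the second term, since [U t.+1] is known at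
    time [t]. At [t = 0] this quantity is [E (L 0)], whence [c * P (U t) <= E (L 0)],
    and continuity from below of [P] concludes.

    Conditional expectations are given by versions and all relations between
    random variables hold almost surely only. Integrals are therefore taken of
    the positive parts [L^\+]: these are nonnegative everywhere, so that
    additivity and monotonicity of the integral need no integrability. *)

Set Implicit Arguments.
Unset Strict Implicit.
Unset Printing Implicit Defensive.

Import Order.TTheory GRing.Theory Num.Theory.

Local Open Scope classical_set_scope.
Local Open Scope ring_scope.

Section ville.
Context d (T : measurableType d) (R : realType) (P : probability T R).
Local Open Scope ereal_scope.

Lemma measurable_wrt_fun d' (T' : measurableType d') (G : set (set T))
    (f : T -> T') : G `<=` measurable -> measurable_wrt G f ->
  measurable_fun setT f.
Proof. by move=> mG mf _ B mB; rewrite setTI; apply/mG/mf. Qed.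

Lemma ae_le_measure (A B : set T) : measurable A -> measurable B ->
  {ae P, forall w, A w -> B w} -> P A <= P B.
Proof.
move=> mA mB [N [mN N0 subN]].
rewrite -(measureU0 mB mN N0); apply: le_measure; rewrite ?inE//.
  exact: measurableU.
move=> w Aw; have [Bw|Bw] := pselect (B w); [by left|right].
by apply: subN => /= /(_ Aw).
Qed.

(** This is the only use made of conditional expectations. Since [Y] is only
    known to be below [g] almost surely and may be negative somewhere, the
    integral of [f] over [A] is first bounded by that of [Y^\+]. *)
Lemma cond_exp_le_integral_funepos (G : set (set T)) (f g Y : T -> \bar R)
    (A : set T) :
  G `<=` measurable -> measurable_fun setT f -> measurable_fun setT g ->
  {ae P, forall w, 0 <= f w} ->
  is_cond_exp P G f Y -> {ae P, forall w, Y w <= g w} -> G A ->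
  \int[P]_(w in A) f^\+ w <= \int[P]_(w in A) g^\+ w.
Proof.
move=> mG mf mg f0 [GY intY] Yg GA; have mA := mG _ GA.
have mY : measurable_fun setT Y by exact: measurable_wrt_fun GY.
have mTA h : measurable_fun setT h -> @measurable_fun _ _ T (\bar R) A h.
  exact: measurable_funTS.
have -> : \int[P]_(w in A) f^\+ w = \int[P]_(w in A) f w.
  apply: ae_eq_integral => //; [|exact: mTA|].
    exact/mTA/measurable_funepos.
  by apply: filterS f0 => w f0 _; rewrite funeposE; apply/max_idPl.
rewrite -intY// integralE.
(* Dropping the integral of [Y^\-] is sound even if both parts have infinite
   integral, because [+oo - +oo] is [-oo]. *)
apply: (@le_trans _ _ (\int[P]_(w in A) Y^\+ w)).
  by rewrite -[leRHS]adde0 leeD2l// oppe_le0 integral_ge0.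
apply: ae_ge0_le_integral => //; [exact/mTA/measurable_funepos|
                                 exact/mTA/measurable_funepos|].
by apply: filterS Yg => w Yg _; rewrite !funeposE ge_max !le_max Yg lexx orbT.
Qed.

Variables (F : nat -> set (set T)) (L : nat -> T -> R).
Hypothesis sF : forall t, sigma_algebra setT (F t).
Hypothesis mF : forall t, F t `<=` measurable.
Hypothesis ndF : forall t, F t `<=` F t.+1.
Hypothesis adL : forall t, measurable_wrt (F t) (L t).
Hypothesis L_ge0 : forall t, {ae P, forall w, (0 <= L t w)%R}.
Hypothesis superL : forall t, exists2 Y,
  is_cond_exp P (F t) (fun w => (L t.+1 w)%:E) Y
  & {ae P, forall w, Y w <= (L t w)%:E}.

Variable c : R.
Hypothesis c_gt0 : (0 < c)%R.

Let C t := [set w | (c <= L t w)%R].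
Let U t := \bigcup_(s in `I_t) C s.
Let Lpos t := (fun w => (L t w)%:E)^\+.

Let FC s t : (s <= t)%N -> F t (C s).
Proof.
have : F s (C s).
  by rewrite /C -preimage_itvcy; apply: adL; exact: measurable_itv.
move=> FCs; elim: t => [|t IH]; first by rewrite leqn0 => /eqP <-.
by rewrite leq_eqVlt => /predU1P[<-//|/IH/ndF].
Qed.

(* [U t.+1] involves the values up to time [t] only: this is what lets the
   supermartingale property be used on its complement. *)
Let FCU t : F t (~` U t.+1).
Proof.
have [F0 FD FU] := sF t.
rewrite -setTD; apply: FD; rewrite /U bigcup_mkcond; apply: FU => s.
case: ifPn => [|_]; last exact: F0; by rewrite inE /= ltnS => /FC.
Qed.

Let mC t : measurable (C t). Proof. exact/mF/FC. Qed.

Let mU t : measurable (U t). Proof. exact: bigcup_measurable. Qed.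

Let mL t : measurable_fun setT (fun w => (L t w)%:E).
Proof. exact/measurable_EFinP/(measurable_wrt_fun (@mF t)). Qed.

(** The bound on the first term alone would not pass from [t] to [t.+1]: the
    second one records what the paths still below [c] can contribute later. *)
Lemma ville_finite_horizon t :
  c%:E * P (U t) + \int[P]_(w in ~` U t) Lpos t w <= \int[P]_w Lpos 0 w.
Proof.
have mLp s A : @measurable_fun _ _ T (\bar R) A (Lpos s).
  exact/measurable_funTS/measurable_funepos.
elim: t => [|t]; first by rewrite /U II0 bigcup_set0 measure0 mule0 add0e setC0.
apply: le_trans.
have US : U t.+1 = U t `|` (C t `\` U t).
  rewrite {1}/U IIS bigcup_setU bigcup_set1; apply/seteqP; split => w /=;
    by have := EM (U t w); rewrite -/(U t); tauto.
have CU : ~` U t = (C t `\` U t) `|` ~` U t.+1.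
  by rewrite US; apply/seteqP; split => w /=; have := EM (C t w); tauto.
have disj (A B D : set T) : A `<=` D -> B `<=` ~` D -> [disjoint A & B].
  move=> AD BD; apply/disj_setPS => w [Aw Bw]; exact: BD Bw (AD _ Aw).
have mCU : measurable (C t `\` U t) by exact: measurableD.
have mUC s : measurable (~` U s) by exact: measurableC.
(* Paths that reach [c] for the first time at [t] contribute [c] times their
   mass to the left term; on the others, one step of the supermartingale. *)
rewrite US measureU//; last by apply/seteqP; split => w //= [? [_]].
rewrite -US ge0_muleDr// -addeA leeD2l// CU ge0_integral_setU//; last 2 first.
- by move=> w _; exact: funepos_ge0.
- by apply: (disj _ _ (U t.+1)) => // w [Cw _]; exists t => //=.
apply: leeD.
  rewrite -integral_cst//; apply: ge0_le_integral => // [w _|w [Cw _]].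
  - by rewrite lee_fin ltW.
  - by rewrite /Lpos funeposE le_max lee_fin Cw.
have [Y GY YL] := superL t.
apply: (cond_exp_le_integral_funepos (@mF t) (mL t.+1) (mL t) _ GY YL) => //.
by apply: filterS (L_ge0 t.+1) => w; rewrite lee_fin.
Qed.

Lemma ville : c%:E * P (\bigcup_t C t) <= \int[P]_w (L 0 w)%:E.
Proof.
have -> : \int[P]_w (L 0 w)%:E = \int[P]_w Lpos 0 w.
  apply: ae_eq_integral => //; first exact: measurable_funepos.
  apply: filterS (L_ge0 0) => w L0 _.
  by rewrite /Lpos funeposE; apply/esym/max_idPl; rewrite lee_fin.
have -> : \bigcup_t C t = \bigcup_t U t.
  apply/seteqP; split => w [t _].
    by exists t.+1 => //; exists t => //=.
  by case=> s _ Cw; exists s.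
rewrite -lee_pdivlMl//.
apply: (@cvge_le _ (\oo) _ _ (P \o U)); last first.
  apply: nondecreasing_cvg_mu => //; first exact: bigcup_measurable.
  move=> m n mn; apply/subsetPset => w [s sm Cw].
  by exists s => //=; exact: leq_trans sm mn.
apply: nearW => t; rewrite lee_pdivlMl//=.
apply: le_trans (ville_finite_horizon t); rewrite leeDl// integral_ge0// => w _.
exact: funepos_ge0.
Qed.

End ville.

Section history.
Context (R : realType).

Lemma measurable_coord i : measurable_fun setT (fun w : itv_seq R => w i).
Proof.
move=> _ B mB; apply: sub_sigma_algebra; exists i => //; exists B => //.
Qed.

Lemma measurable_history t : measurable_fun setT (@history R t).
Proof.
apply/measurable_fun_tnthP => i.
apply: (eq_measurable_fun (fun w : itv_seq R => w i)).
  by move=> w _; rewrite /= tnth_mktuple.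
exact: measurable_coord.
Qed.

Lemma filtration_sigma_algebra t : sigma_algebra setT (@filtration R t).
Proof. exact/sigma_algebra_preimage/sigma_algebra_measurable. Qed.

Lemma filtration_measurable t : @filtration R t `<=` measurable.
Proof. by move=> _ [B mB <-]; exact: measurable_history. Qed.

(** The history at time [t] is a measurable function, truncation, of the history
    at time [t.+1]. *)
Lemma filtration_nondecreasing t : @filtration R t `<=` filtration t.+1.
Proof.
pose pre (x : t.+1.-tuple (unit_itv R)) : t.-tuple (unit_itv R) :=
  [tuple tnth x (widen_ord (leqnSn t) i) | i < t].
have mpre : measurable_fun setT pre.
  apply/measurable_fun_tnthP => i.
  apply: (eq_measurable_fun
    (fun x : t.+1.-tuple (unit_itv R) => tnth x (widen_ord (leqnSn t) i))).
    by move=> x _; rewrite /= tnth_mktuple.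
  exact: measurable_tnth.
move=> _ [B mB <-]; exists (pre @^-1` B).
  by have := mpre measurableT _ mB; rewrite setTI.
have -> : @history R t = pre \o @history R t.+1.
  by apply/funext => w; apply: eq_from_tnth => i; rewrite !tnth_mktuple.
by rewrite !setTI.
Qed.

End history.

Lemma test_martingale_super (R : realType) (P : probability (itv_seq R) R) L :
  test_martingale P L -> test_supermartingale P L.
Proof.
move=> [L1 martL]; split => // t; have [Y GY YL] := martL t.
by exists Y => //; apply: filterS YL => w ->.
Qed.

Theorem theorem1 (R : realType) (alpha : R) (mu : unit_itv R)
  (M : unit_itv R -> forall t : nat, t.-tuple (unit_itv R) -> R)
  (alpha01 : 0 < alpha < 1)
  (M_meas : forall m t, measurable_fun setT (M m t))
  (M_ge0 : forall m t x, 0 <= M m t x)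
  (M_bounded : forall P, mean_distributions mu P ->
     exists2 L : nat -> itv_seq R -> R,
       test_supermartingale P L \/ test_martingale P L
       & forall t, {ae P, forall w, M mu t (history t w) <= L t w}) :
  (ereal_sup [set P [set w | exists2 t : nat, (1 <= t)%N
                                & ~ confidence_set alpha M t w mu]
             | P in mean_distributions mu] <= alpha%:E)%E.
Proof.
have [alpha0 _] := andP alpha01.
apply: ge_ereal_sup => _ [P muP <-].
have [L Ltest ML] := M_bounded P muP.
have [[adL L_ge0 L01] superL] : test_supermartingale P L.
  by case: Ltest => // /test_martingale_super.
pose C t := [set w | alpha^-1 <= L t w].
have Cville := ville (@filtration_sigma_algebra R) (@filtration_measurable R)
  (@filtration_nondecreasing R) adL L_ge0 superL.
have mL t : measurable_fun setT (L t).
  exact: measurable_wrt_fun (@filtration_measurable R t) (adL t).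
pose D t := [set w | alpha^-1 <= M mu t (history t w)].
have mge (f : itv_seq R -> R) :
    measurable_fun setT f -> measurable [set w | alpha^-1 <= f w].
  move=> mf; rewrite -[X in measurable X]setTI.
  by rewrite -preimage_itvcy; apply: mf => //; exact: measurable_itv.
have -> : [set w | exists2 t, (1 <= t)%N & ~ confidence_set alpha M t w mu] =
    \bigcup_(t in [set t | (1 <= t)%N]) D t.
  apply/seteqP; split => w [t t1] Dw; exists t => //; move: Dw;
    rewrite /confidence_set /D /level_test/= indicE div1r.
    by case: (boolP (_ \in _)) => [|_ []//]; rewrite inE.
  by move=> Dw; rewrite mem_set//=; apply/eqP; exact: oner_neq0.
apply: (@le_trans _ _ (P (\bigcup_t C t))).
  apply: ae_le_measure.
  - apply: bigcup_measurable => t _; apply: mge.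
    exact: measurableT_comp (M_meas mu t) (@measurable_history R t).
  - by apply: bigcup_measurable => t _; exact: mge.
  - have := ae_foralln ML; apply: filterS => w MLw [t _ Dw].
    by exists t => //; exact: le_trans Dw (MLw t).
have := Cville alpha^-1; rewrite invr_gt0 => /(_ alpha0).
rewrite lee_pdivrMl// => /le_trans; apply.
rewrite (ae_eq_integral (cst 1%E))//.
  rewrite integral_cst// mul1e -[leRHS]mule1 lee_pmul2l//.
  exact: probability_le1.
- exact/measurable_EFinP.
- by apply: filterS L01 => w -> _.
Qed.
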